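(* The edit path distance $\operatorname{d}$ is a pseudo-metric on the set of merge trees $Mer$, on the set of strict merge trees $Mer_<$, and on the set of well-branched merge trees $Mer_{wb}$.
   Context: Posets of merge tree type. A poset $P$ is of merge tree type if it is finite, has a unique maximum $r$ (the root), for each $a\in P$ the interval $[a,r]$ is a chain, and each non-minimal element covers at least two distinct elements. Minimal elements are leaves, non-minimal elements are inner nodes; if $y$ covers $x$, then $y$ is the parent of $x$ and $x$ a child of $y$. Fix one representative for each isomorphism class of posets of merge tree type; $Mer_{comb}$ is the set of these representatives (target posets are always identified with the chosen representatives via isomorphisms). Merge trees. $Mer=\coprod_{P\in Mer_{comb}}\operatorname{Map}_\le(P,\mathbb{R})$ (order-preserving maps), $Mer_<=Mer_{st}=\coprod_{P\in Mer_{comb}}\operatorname{Map}_<(P,\mathbb{R})$ (strictly order-preserving maps), and $Mer_{wb}\subset Mer_{st}$ consists of those $\theta$ such that for every node $y$ the restriction of $\theta$ to $\{x\mid x\le y\}$ attains its minimum at a unique element. $s(\theta)$ denotes the domain of $\theta$. Edit moves on a poset $P$ of merge tree type: (i) the identity; (ii) adding a leaf: a new minimal element $x$ is added, either as a child of an existing inner node $y$, or together with a new inner node $y'$ inserted between existing elements $z_1<z_2$ with $z_2$ the parent of $z_1$, with $x$ a child of $y'$; exceptionally, if $P=\{r\}$, two leaves below $r$ are added simultaneously; (iii) removing a leaf (inverse of adding a leaf): a leaf $x$ is removed and, if its parent is left with only one child, that parent is removed too (in the exceptional case both leaves of a two-leaf tree with one inner node are removed); (iv) splitting an inner node: a node $z$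 with at least $3$ children is replaced by two nodes $z_1<z_2$ with $z_2$ covering $z_1$, the children of $z$ being distributed so that $z_1$ gets at least two and $z_2$ gets at least one besides $z_1$; (v) merging two adjacent inner nodes $z_1<z_2$ ($z_2$ covering $z_1$) into one node $z$ having all their other children (inverse of splitting). An elementary edit morphism $P\to P'$ is one edit move composed with an automorphism of $P'$. A composition of elementary edit morphisms is in the same direction if all of them are additions of leaves and splittings of inner nodes, or all of them are removals of leaves and merges of inner nodes (identities being allowed in both). Shift of height functions. Let $\eta\colon P\to P'$ be a composition of additions of leaves and splittings. It induces an injection $\eta\colon P\to P'$: existing nodes are included, and a node $z$ that is split is sent to the larger new node $z_2$. For $\theta\in\operatorname{Map}_\le(P,\mathbb{R})$ and $\theta'\in\operatorname{Map}_\le(P',\mathbb{R})$, define $\eta_*(\theta,\theta')\colon P'\to\mathbb{R}$ by: $\eta_*(\theta,\theta')_x=\theta_{\eta^{-1}(x)}$ if $x\in\eta(P)$; $=\theta_{\eta^{-1}(y)}$ if $x\notin\eta(P)$ is a leaf whose parent $y$ in $P'$ lies in $\eta(P)$; $=\theta'_x$ if $x\notin\eta(P)$ was added as a new parent node for a new leaf (nodes split off such an added node are treated the same way); $=\theta'_y$ if $x\notin\eta(P)$ is a leaf whose parent $y$ in $P'$ is not in $\eta(P)$; $=\theta_y$ if $x\notin\eta(P)$ is an inner node that was split off from the node $y$ of $P$. Edit path distance. Let $\theta,\theta'$ be merge trees. Consider finite sequences $\gamma=(\eta_0,\dots,\eta_n)$ where $\eta_i\colon P_i\to P_{i+1}$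 is a composition of elementary edit morphisms in the same direction, $P_0=s(\theta)$, $P_{n+1}=s(\theta')$. The length is $\lambda(\gamma)=\inf_{\bar\gamma}\sum_{i=0}^n\|{\eta_i}_*\gamma_i-\gamma_{i+1}\|$, the infimum being over all sequences of height functions $\gamma_i\in\operatorname{Map}_\le(P_i,\mathbb{R})$ with $\gamma_0=\theta$, $\gamma_{n+1}=\theta'$; here $\|\cdot\|$ is the Euclidean norm and $\|{\eta_i}_*\gamma_i-\gamma_{i+1}\|$ means $\|{\eta_i}_*(\gamma_i,\gamma_{i+1})-\gamma_{i+1}\|$ (in $\mathbb{R}^{P_{i+1}}$) if $\eta_i$ consists of additions and splittings, and $\|(\eta_i^{-1})_*(\gamma_{i+1},\gamma_i)-\gamma_i\|$ (in $\mathbb{R}^{P_i}$) if $\eta_i$ consists of removals and merges. Finally $\operatorname{d}(\theta,\theta')=\inf_{\gamma}\lambda(\gamma)$. On $Mer_<$ and $Mer_{wb}$ the distance $\operatorname{d}$ is the restriction. *)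

(* Defs.v *)
From HB Require Import structures.
From mathcomp Require Import all_boot all_order all_algebra.
From mathcomp Require Import boolp classical_sets reals constructive_ereal ereal.

Set Implicit Arguments.
Unset Strict Implicit.
Unset Printing Implicit Defensive.

Import Order.TTheory GRing.Theory Num.Theory.

Local Open Scope order_scope.

Section MergeTreeType.
Context {d : Order.disp_t}.
Implicit Types P : finPOrderType d.

(* [covers y x]: y is the parent of x, and x is a child of y. *)
Definition covers P (y x : P) : bool :=
  (x < y) && [forall z, ~~ ((x < z) && (z < y))].

Definition children P (y : P) : {set P} := [set x | covers y x].

Definition leaf P (x : P) : bool := [forall z, ~~ (z < x)].

Definition inner P (x : P) : bool := ~~ leaf x.

Definition merge_tree_type P : Prop :=
  exists r : P,
    [/\ forall x, x <= r,
        forall a : P, {in [pred x | (a <= x) && (x <= r)] &,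
                       forall x y, x >=< y}
      & forall x : P, inner x -> (1 < #|children x|)%N].

Definition order_isomorphic P (Q : finPOrderType d) : Prop :=
  exists2 f : P -> Q, bijective f & {mono f : x y / x <= y}.

End MergeTreeType.

(* A choice of one representative for each isomorphism class of posets of merge
   tree type.  It is a family over an index type because a set of finite posets
   does not fit in the universe of [set]; an index is used as the poset that it
   denotes. *)
Record representatives d := Representatives {
  rep_index :> Type;
  rep_poset : rep_index -> finPOrderType d;
  rep_merge_tree_type : forall P : rep_index, merge_tree_type (rep_poset P);
  rep_unique : forall Q : finPOrderType d, merge_tree_type Q ->
    exists! P : rep_index, order_isomorphic Q (rep_poset P) }.

Arguments rep_poset {d r}.
Coercion rep_poset : rep_index >-> Order.FinPOrder.type.

Section Existence.
Context (d : Order.disp_t).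

Let order_code (n : nat) := 'I_n -> 'I_n -> bool.
Let code := {n : nat & order_code n}.

Let codes (Q : finPOrderType d) : set code :=
  [set c | exists2 f : 'I_(tag c) -> Q, bijective f &
    forall x y, (f x <= f y) = (tagged c : order_code (tag c)) x y].

Let index : Type :=
  {K : set code | exists2 Q : finPOrderType d, merge_tree_type Q & K = codes Q}.

Let poset_of (K : index) : finPOrderType d := s2val (cid2 (svalP K)).

Let codes_poset_of K : sval K = codes (poset_of K).
Proof. exact: s2valP' (cid2 (svalP K)). Qed.

Let codes_iso (Q Q' : finPOrderType d) :
  order_isomorphic Q Q' <-> codes Q = codes Q'.
Proof.
split=> [[g bg mg]|eqQ].
  case: (bg) => h gK hK; apply/seteqP; split=> c /= [f bf fE].
    by exists (g \o f) => [|x y /=]; [exact: bij_comp|rewrite mg fE].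
  exists (h \o f) => [|x y /=]; first by apply: bij_comp => //; exists g.
  by rewrite -mg !hK fE.
pose c : code := Tagged order_code
  (fun i j : 'I_#|Q| => enum_val i <= enum_val j :> Q).
have : codes Q c by exists (@enum_val _ Q) => //; exact: enum_val_bij.
rewrite eqQ => -[f bf fE].
exists (f \o enum_rank) => [|x y /=]; last by rewrite fE /= !enum_rankK.
by apply: bij_comp => //; exact: enum_rank_bij.
Qed.

Lemma representatives_inhabited : inhabited (representatives d).
Proof.
constructor; apply: (@Representatives d index poset_of) => [K|Q tQ].
  exact: s2valP (cid2 (svalP K)).
have eK : exists2 Q', merge_tree_type Q' & codes Q = codes Q' by exists Q.
exists (exist _ (codes Q) eK); split.
  by apply/codes_iso; rewrite -codes_poset_of.
move=> K /codes_iso; rewrite -codes_poset_of; case: K => K pK /= eqK.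
exact: eq_exist.
Qed.

End Existence.

(* A composition P -> P' of additions of leaves and splittings is recorded by
   two maps:
   - [eta : P -> P'], the induced injection;
   - [o : P' -> option P], with [o x = Some y] when x is the image of y or was
     split off (possibly in several stages) from the node y of P, and
     [o x = None] when x is an added leaf, an added parent of a new leaf, or a
     node split off from such an added parent.
   Since eta is an arbitrary order embedding into P', and not an inclusion, the
   identification of the target of a move with its chosen representative is
   built into the definitions. *)
Section Moves.
Context {d : Order.disp_t}.

Section OneMove.
Context {P P' : finPOrderType d}.
Implicit Types (eta : P -> P') (o : P' -> option P).

Definition adds_leaf_to_inner_node eta : Prop :=
  exists (y : P) (x : P'),
    [/\ inner y,
        forall w, (w \in codom eta) = (w != x),
        leaf x
      & covers (eta y) x].

Definition adds_leaf_with_parent eta : Prop :=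
  exists (z1 z2 : P) (x y' : P'),
    [/\ covers z2 z1,
        x != y' /\ forall w, (w \in codom eta) = (w \notin [:: x; y']),
        leaf x,
        children y' = [set x; eta z1]
      & covers (eta z2) y'].

Definition adds_two_leaves_to_point eta : Prop :=
  exists (r : P) (x1 x2 : P'),
    [/\ forall z : P, z = r,
        x1 != x2 /\ forall w, (w \in codom eta) = (w \notin [:: x1; x2]),
        leaf x1 /\ leaf x2
      & covers (eta r) x1 /\ covers (eta r) x2].

Definition adds_leaf eta o : Prop :=
  [/\ {mono eta : x y / x <= y},
      forall x, o (eta x) = Some x,
      forall x, x \notin codom eta -> o x = None
    & [\/ adds_leaf_to_inner_node eta,
          adds_leaf_with_parent eta
        | adds_two_leaves_to_point eta]].

(* The node z is replaced by z1 < z2 with z2 = eta z. *)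
Definition splits_inner_node eta o : Prop :=
  exists (z : P) (z1 : P'),
    [/\ {mono eta : x y / x <= y} /\
          (forall w, (w \in codom eta) = (w != z1)),
        (forall x, o (eta x) = Some x) /\ o z1 = Some z,
        (2 < #|children z|)%N,
        covers (eta z) z1 /\
          (forall w, covers z w = covers z1 (eta w) || covers (eta z) (eta w))
      & (1 < #|children z1|)%N /\ (0 < #|children (eta z) :\ z1|)%N].

End OneMove.

Context {Mer_comb : representatives d}.

Inductive growing_move :
    forall P P' : Mer_comb, (P -> P') -> (P' -> option P) -> Prop :=
| move_id (P : Mer_comb) : @growing_move P P id Some
| move_add (P P' : Mer_comb) (eta : P -> P') (o : P' -> option P) :
    adds_leaf eta o -> growing_move eta o
| move_split (P P' : Mer_comb) (eta : P -> P') (o : P' -> option P) :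
    splits_inner_node eta o -> growing_move eta o.

Definition automorphism (P : Mer_comb) (phi : P -> P) : Prop :=
  bijective phi /\ {mono phi : x y / x <= y}.

(* A growing move P -> P' followed by an automorphism phi of P'. *)
Definition elementary_growth (P P' : Mer_comb)
    (eta : P -> P') (o : P' -> option P) : Prop :=
  exists (eta0 : P -> P') (o0 : P' -> option P) (phi : P' -> P'),
    [/\ growing_move eta0 o0, automorphism phi,
        forall x, eta x = phi (eta0 x) & forall x, o (phi x) = o0 x].

(* Removals of leaves and merges are the inverses of the growing moves.  Here
   the growing data [eta : P -> P'] describe the inverse of an elementary edit
   morphism P' -> P that is the inverse of a growing move [eta0 : P -> P']
   followed by an automorphism phi of its target P. *)
Definition elementary_shrinking_inv (P P' : Mer_comb)
    (eta : P -> P') (o : P' -> option P) : Prop :=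
  exists (eta0 : P -> P') (o0 : P' -> option P) (phi : P -> P),
    [/\ growing_move eta0 o0, automorphism phi,
        forall x, eta (phi x) = eta0 x & forall x, o x = omap phi (o0 x)].

Inductive composite
    (E : forall P P' : Mer_comb, (P -> P') -> (P' -> option P) -> Prop) :
    forall P P' : Mer_comb, (P -> P') -> (P' -> option P) -> Prop :=
| composite_one (P P' : Mer_comb) (eta : P -> P') (o : P' -> option P) :
    E P P' eta o -> composite E eta o
| composite_comp (P Q P' : Mer_comb)
    (eta1 : P -> Q) (o1 : Q -> option P)
    (eta2 : Q -> P') (o2 : P' -> option Q) :
    composite E eta1 o1 -> composite E eta2 o2 ->
    composite E (eta2 \o eta1) (obind o1 \o o2).

(* A composition P -> P' of elementary edit morphisms in the same direction;
   in the decreasing direction it is given through its inverse P' -> P. *)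
Inductive edit_morphism (P P' : Mer_comb) : Type :=
| Grow (eta : P -> P') (o : P' -> option P)
    of composite elementary_growth eta o
| Shrink (eta : P' -> P) (o : P -> option P')
    of composite elementary_shrinking_inv eta o.

(* Nonempty finite sequences eta_0, ..., eta_n of composable morphisms. *)
Inductive edit_path : Mer_comb -> Mer_comb -> Type :=
| path_one (P Q : Mer_comb) : edit_morphism P Q -> edit_path P Q
| path_cons (P Q S : Mer_comb) :
    edit_morphism P Q -> edit_path Q S -> edit_path P S.

End Moves.

Local Open Scope ring_scope.

Section Distance.
Context {R : realType} {d : Order.disp_t}.

Section Shift.
Context {P P' : finPOrderType d}.

(* A leaf of P' outside the image of eta always has a parent, so the branch
   [theta' x] for leaves is never reached for trees. *)
Definition shift (eta : P -> P') (o : P' -> option P)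
    (theta : P -> R) (theta' : P' -> R) (x : P') : R :=
  let preimage u := [pick z | eta z == u] in
  if preimage x is Some z then theta z
  else if leaf x then
    if [pick y | covers y x] is Some y then
      if preimage y is Some z then theta z else theta' y
    else theta' x
  else if o x is Some y then theta y else theta' x.

End Shift.

Definition euclidean_norm (P : finPOrderType d) (f : P -> R) : R :=
  Num.sqrt (\sum_(x : P) f x ^+ 2).

Context {Mer_comb : representatives d}.

Definition step_cost (P P' : Mer_comb) (m : edit_morphism P P')
    (theta : P -> R) (theta' : P' -> R) : R :=
  match m with
  | Grow eta o _ =>
      euclidean_norm (fun x => shift eta o theta theta' x - theta' x)
  | Shrink eta o _ =>
      euclidean_norm (fun x => shift eta o theta' theta x - theta x)
  end.

(* The intermediate height functions gamma_1, ..., gamma_n along a path. *)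
Fixpoint heights (P S : Mer_comb) (gamma : edit_path P S) : Type :=
  match gamma with
  | path_one _ _ _ => unit
  | path_cons _ Q _ _ gamma' => ({omorphism Q -> R} * heights gamma')%type
  end.

Fixpoint path_cost (P S : Mer_comb) (gamma : edit_path P S) :
    (P -> R) -> (S -> R) -> heights gamma -> R :=
  match gamma with
  | path_one _ _ m => fun theta theta' _ => step_cost m theta theta'
  | path_cons _ _ _ m gamma' => fun theta theta' h =>
      step_cost m theta h.1 + @path_cost _ _ gamma' h.1 theta' h.2
  end.

Definition path_length (P S : Mer_comb) (gamma : edit_path P S)
    (theta : P -> R) (theta' : S -> R) : \bar R :=
  ereal_inf [set (path_cost theta theta' h)%:E | h in [set: heights gamma]].

End Distance.

Section MergeTrees.
Context (R : realType) {d : Order.disp_t} (Mer_comb : representatives d).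

Definition Mer : Type := {P : Mer_comb & {omorphism P -> R}}.

Definition domain (theta : Mer) : Mer_comb := tag theta.

Definition height (theta : Mer) : {omorphism domain theta -> R} :=
  tagged theta.

Definition Mer_st : set Mer :=
  [set theta | {homo height theta : x y / (x < y)%O}].

Definition Mer_wb : set Mer :=
  [set theta | Mer_st theta /\
    forall y : domain theta, exists! x : domain theta,
      (x <= y)%O /\
      forall z : domain theta, (z <= y)%O -> height theta x <= height theta z].

Definition edit_distance (theta theta' : Mer) : \bar R :=
  ereal_inf [set path_length gamma (height theta) (height theta')
            | gamma in [set: edit_path (domain theta) (domain theta')]].

End MergeTrees.

Arguments Mer_st {R d Mer_comb}.
Arguments Mer_wb {R d Mer_comb}.
Arguments edit_distance {R d Mer_comb}.

Definition pseudo_metric_on (R : realType) (T : Type) (A : set T)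
    (dist : T -> T -> \bar R) : Prop :=
  [/\ forall x y, A x -> A y -> (0 <= dist x y < +oo)%E,
      forall x, A x -> dist x x = 0%E,
      forall x y, A x -> A y -> dist x y = dist y x
    & forall x y z, A x -> A y -> A z ->
        (dist x z <= dist x y + dist y z)%E].

(* Main.v *)
(* Moves invert one another, so concatenating and reversing edit paths together
   with their height functions gives the triangle inequality and symmetry.
   Finiteness amounts to connecting any two trees by a path: in a tree with more
   than one node take a minimal inner node y, all of whose children are leaves.
   One removal applies to it: drop a leaf if y has at least three children, drop
   y and a leaf if y has two children and a parent, and drop both leaves if y is
   the root with two children.  Iterating leads every tree to the point. *)
Require Import Defs.
From HB Require Import structures.
From mathcomp Require Import all_boot all_order all_algebra.
From mathcomp Require Import classical_sets reals constructive_ereal ereal.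

Set Implicit Arguments.
Unset Strict Implicit.
Unset Printing Implicit Defensive.

Import Order.TTheory GRing.Theory Num.Theory.

Local Open Scope order_scope.

(** * Covers and extremal elements in finite posets *)

Section FinitePosets.
Context {d : Order.disp_t} {P : finPOrderType d}.
Implicit Types (x y z : P) (A : pred P).

Let below x := [set z | z <= x].

(** The size of the down-set is a strictly increasing rank, so maximizing or minimizing it over a
    predicate yields a maximal or minimal element. *)
Let ltn_below x y : x < y -> (#|below x| < #|below y|)%N.
Proof.
move=> xy; apply/proper_card/fintype.properP; split.
  by apply/fintype.subsetP => z; rewrite !inE => /le_trans; apply; exact: ltW.
by exists y; rewrite !inE ?lexx ?(lt_geF xy).
Qed.

Lemma exists_maximal A x :
  A x -> exists2 m, A m & forall z, A z -> ~~ (m < z).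
Proof.
move=> Ax; case: (@arg_maxnP _ x A (fun z => #|below z|) Ax) => m Am mM.
exists m => // z /mM; apply: contraL => /ltn_below.
by rewrite -ltnNge.
Qed.

Lemma exists_minimal A x :
  A x -> exists2 m, A m & forall z, A z -> ~~ (z < m).
Proof.
move=> Ax; case: (@arg_minnP _ x A (fun z => #|below z|) Ax) => m Am mM.
exists m => // z /mM; apply: contraL => /ltn_below.
by rewrite -ltnNge.
Qed.

Lemma covers_lt y x : covers y x -> x < y.
Proof. by case/andP. Qed.

Lemma covers_between y x z : covers y x -> x < z -> z < y -> False.
Proof. by case/andP=> _ /forallP/(_ z); rewrite negb_and => /orP[]/negPf->. Qed.

(** A maximal element of the half-open interval from [x] to [y] is covered by [y]. *)
Lemma exists_child x y : x < y -> exists2 c, covers y c & x <= c.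
Proof.
move=> xy; have Ax : [pred z | (x <= z) && (z < y)] x by rewrite /= lexx.
have [c /= /andP[xc cy] cM] := exists_maximal Ax; exists c => //.
rewrite /covers cy; apply/forallP => z; apply/negP => /andP[cz zy].
by have := cM z; rewrite /= zy (le_trans xc (ltW cz)) cz => /(_ isT).
Qed.

Lemma exists_parent x y : x < y -> exists p, covers p x.
Proof.
move=> xy; have [p xp pM] := @exists_minimal (fun z => x < z) y xy.
exists p; rewrite /covers xp; apply/forallP => z; apply/negP => /andP[xz].
exact/negP/pM.
Qed.

Lemma leafP x : reflect (forall z, ~~ (z < x)) (leaf x).
Proof. exact: forallP. Qed.

Lemma innerP x : reflect (exists z, z < x) (inner x).
Proof.
rewrite /inner negb_forall.
by apply: (iffP existsP) => -[z]; [rewrite negbK|]; exists z; rewrite ?negbK.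
Qed.

End FinitePosets.

(** * Unique parents, and invariance of moves under isomorphism *)

Section MergeTreePosets.
Context {d : Order.disp_t}.
Implicit Types P Q : finPOrderType d.

(** Two parents of [x] lie in the chain above [x]; if they differed, the smaller would lie strictly
    between [x] and the larger. *)
Lemma parent_unique P (x y z : P) :
  merge_tree_type P -> covers y x -> covers z x -> y = z.
Proof.
move=> [r [rM chain _]] yx zx.
have : y >=< z.
  by apply: (chain x); rewrite inE rM andbT ltW // (covers_lt yx, covers_lt zx).
case: comparableP => // [yz|zy] _.
- by case: (covers_between zx (covers_lt yx) yz).
- by case: (covers_between yx (covers_lt zx) zy).
Qed.

Section Isomorphism.
Context {P Q : finPOrderType d} (f : P -> Q).
Hypotheses (bij_f : bijective f) (mono_f : {mono f : x y / x <= y}).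

Lemma covers_iso x y : covers (f y) (f x) = covers y x.
Proof.
have [g fK gK] := bij_f; have lt_f := leW_mono mono_f.
rewrite /covers lt_f; congr andb; apply/forallP/forallP => H z.
  by rewrite -!lt_f; exact: H.
by rewrite -[z]gK !lt_f; exact: H.
Qed.

Lemma leaf_iso x : leaf (f x) = leaf x.
Proof.
have [g fK gK] := bij_f; have lt_f := leW_mono mono_f.
apply/forallP/forallP => H z; first by rewrite -lt_f; exact: H.
by rewrite -[z]gK lt_f; exact: H.
Qed.

Lemma children_iso y : children (f y) = f @: children y.
Proof.
have [g fK gK] := bij_f.
apply/setP => z; rewrite -[z]gK mem_imset; last exact: can_inj fK.
by rewrite !inE covers_iso.
Qed.

Lemma card_children_iso y : #|children (f y)| = #|children y|.
Proof. by rewrite children_iso card_imset //; exact: bij_inj. Qed.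

Lemma card_childrenD1_iso y x :
  #|children (f y) :\ f x| = #|children y :\ x|.
Proof.
(* Adding the indicator of membership turns both punctured sets back into full sets of children. *)
apply: (@addnI (f x \in children (f y))).
by rewrite -cardsD1 card_children_iso (cardsD1 x) !inE covers_iso.
Qed.

End Isomorphism.

Section MoveIsomorphism.
Context {P P' Q Q' : finPOrderType d}.
Context (f : P -> Q) (g : P' -> Q').
Hypotheses (bij_f : bijective f) (mono_f : {mono f : x y / x <= y}).
Hypotheses (bij_g : bijective g) (mono_g : {mono g : x y / x <= y}).
Context (eta : P -> P') (o : P' -> option P).
Context (eta' : Q -> Q') (o' : Q' -> option Q).
Hypotheses (eta'E : forall x, eta' (f x) = g (eta x)).
Hypotheses (o'E : forall x, o' (g x) = omap f (o x)).

Let codom_iso w : (g w \in codom eta') = (w \in codom eta).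
Proof.
have [f' fK f'K] := bij_f.
apply/codomP/codomP => -[x].
  by rewrite -[x]f'K eta'E => /(bij_inj bij_g) ->; exists (f' x).
by move=> ->; exists (f x).
Qed.

(** This serves two purposes: absorbing an automorphism into a move ([f] or [g] the identity), and
    replacing a pruned tree by its chosen representative. *)
Lemma adds_leaf_iso : adds_leaf eta o -> adds_leaf eta' o'.
Proof.
have [f' fK f'K] := bij_f; have [g' gK g'K] := bij_g.
have g_inj := bij_inj bij_g.
move=> [mono_eta oK oN H]; split.
- by move=> x y; rewrite -[x]f'K -[y]f'K !eta'E mono_g mono_eta mono_f.
- by move=> x; rewrite -[x]f'K eta'E o'E oK.
- by move=> x; rewrite -[x]g'K codom_iso o'E => /oN ->.
case: H => [[y [x [iy cx lx yx]]]|[z1 [z2 [x [y [z12 [xy cx] lx ch yz]]]]]|].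
- apply: Or31; exists (f y), (g x); split.
  + by rewrite /inner leaf_iso.
  + by move=> w; rewrite -[w]g'K codom_iso cx (inj_eq g_inj).
  + by rewrite leaf_iso.
  + by rewrite eta'E covers_iso.
- apply: Or32; exists (f z1), (f z2), (g x), (g y); split.
  + by rewrite covers_iso.
  + rewrite (inj_eq g_inj); split=> // w.
    by rewrite -[w]g'K codom_iso cx !inE !(inj_eq g_inj).
  + by rewrite leaf_iso.
  + by rewrite children_iso // ch imsetU1 imset_set1 eta'E.
  + by rewrite eta'E covers_iso.
- move=> [r [x1 [x2 [rU [x12 cx] [l1 l2] [c1 c2]]]]].
  apply: Or33; exists (f r), (g x1), (g x2); split.
  + by move=> z; rewrite -[z]f'K (rU (f' z)).
  + rewrite (inj_eq g_inj); split=> // w.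
    by rewrite -[w]g'K codom_iso cx !inE !(inj_eq g_inj).
  + by rewrite !leaf_iso.
  + by rewrite eta'E !covers_iso.
Qed.

Lemma splits_inner_node_iso :
  splits_inner_node eta o -> splits_inner_node eta' o'.
Proof.
have [f' fK f'K] := bij_f; have [g' gK g'K] := bij_g.
have g_inj := bij_inj bij_g.
move=> [z [z1 [[mono_eta cz1] [oK oz1] z2 [zz1 ch] [c1 c2]]]].
exists (f z), (g z1); split.
- split=> [x y|w].
    by rewrite -[x]f'K -[y]f'K !eta'E mono_g mono_eta mono_f.
  by rewrite -[w]g'K codom_iso cz1 (inj_eq g_inj).
- by split=> [x|]; [rewrite -[x]f'K eta'E o'E oK|rewrite o'E oz1].
- by rewrite card_children_iso.
- rewrite eta'E covers_iso //; split=> // w.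
  rewrite -[w]f'K eta'E (covers_iso bij_f mono_f).
  by rewrite !(covers_iso bij_g mono_g).
- rewrite card_children_iso //; split=> //.
  by rewrite eta'E card_childrenD1_iso.
Qed.

End MoveIsomorphism.

(** * Induced subposets *)

Definition subposet P (A : pred P) : Type := {x | A x}.

HB.instance Definition _ P (A : pred P) := Finite.on (subposet A).
HB.instance Definition _ P (A : pred P) := SubType.copy (subposet A) {x | A x}.
HB.instance Definition _ P (A : pred P) :=
  [SubChoice_isSubPOrder of subposet A by <: with d].

Section Subposet.
Context {P : finPOrderType d} (A : pred P).
Notation Q := (subposet A).

(** Passing to a subposet leaves fewer candidates in between. The converse fails, since deleting an
    intermediate element can create a cover. *)
Lemma covers_subposet (w u : Q) : covers (val w) (val u) -> covers w u.
Proof.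
move=> wu; rewrite /covers -lt_val (covers_lt wu); apply/forallP => z.
apply/negP => /andP[]; rewrite -!lt_val => uz zw.
exact: covers_between wu uz zw.
Qed.

(** A subposet that keeps the root inherits the chain condition, so only the number of children
    remains to be checked. *)
Lemma merge_tree_type_subposet (r : P) :
    merge_tree_type P -> A r -> (forall x : P, x <= r) ->
    (forall w : Q, inner w -> (1 < #|children w|)%N) ->
  merge_tree_type Q.
Proof.
move=> [r' [r'M chain _]] Ar rM ch; exists (Sub r Ar); split=> //.
  by move=> x; rewrite -Order.le_val SubK.
move=> a x y /andP[+ _] /andP[+ _]; rewrite -!Order.le_val => ax ay.
have := chain (val a) (val x) (val y); rewrite !inE !r'M ax ay.
by rewrite /Order.comparable !Order.le_val; apply.
Qed.

(** Here [insub] is the right origin map: kept elements come from themselves, deleted ones from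
    nothing. *)
Lemma adds_leaf_subposet :
    [\/ adds_leaf_to_inner_node (val : Q -> P),
        adds_leaf_with_parent (val : Q -> P)
      | adds_two_leaves_to_point (val : Q -> P)] ->
  adds_leaf (val : Q -> P) insub.
Proof.
split=> //.
- by move=> x; rewrite valK.
- by move=> x; rewrite codom_val; exact: insubN.
Qed.

End Subposet.

(** * The three kinds of leaf removal *)

Section Pruning.
Context {P : finPOrderType d} (treeP : merge_tree_type P) (y : P).

(* A third child keeps [y] inner with at least two children. *)
Lemma remove_leaf_sibling (x : P) :
    covers y x -> leaf x -> (2 < #|children y|)%N ->
  let A : pred P := predC1 x in
  merge_tree_type (subposet A) /\
  adds_leaf_to_inner_node (val : subposet A -> P).
Proof.
move=> yx lx ch A.
have [r [rM chain two]] := treeP.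
have Alt w z : z < w -> A w.
  by move=> zw; apply: contraTneq zw => ->; exact: (leafP _ lx).
have Ay : A y := Alt _ _ (covers_lt yx).
have Ar : A r := Alt _ _ (lt_le_trans (covers_lt yx) (rM y)).
have big_child (w : subposet A) :
    inner w -> exists a b,
      [/\ A a, A b, a != b, covers (val w) a & covers (val w) b].
  move=> /innerP[u]; rewrite -lt_val => uw.
  have [wy|wy] := eqVneq (val w) y.
    (* Among three distinct children of [y], at least two differ from [x]. *)
    have [a [b [c [[]]]]] := card_gt2P ch.
    rewrite !inE => ya yb yc [ab bc ca]; rewrite wy.
    have [ax|ax] := eqVneq a x.
      by exists b, c; split=> //; rewrite /A /= -ax // eq_sym.
    have [bx|bx] := eqVneq b x; last by exists a, b.
    by exists a, c; split=> //; rewrite ?(eq_sym a) // /A /= -bx eq_sym.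
  (* Away from [y] no child is lost, because [y] is the only parent of [x]. *)
  have /card_gt1P[a [b []]] : (1 < #|children (val w)|)%N.
    by apply: two; apply/innerP; exists (val u).
  rewrite !inE => wa wb ab.
  exists a, b; split=> //; rewrite /A /=; apply: contra_neq wy => eqx.
    by apply: (parent_unique treeP _ yx); rewrite -eqx.
  by apply: (parent_unique treeP _ yx); rewrite -eqx.
split.
  apply: (merge_tree_type_subposet treeP Ar rM) => w.
  case/big_child => a [b [Aa Ab ab wa wb]].
  apply/card_gt1P; exists (Sub a Aa), (Sub b Ab); split.
  - by rewrite inE covers_subposet ?SubK.
  - by rewrite inE covers_subposet ?SubK.
  - by rewrite -val_eqE !SubK.
exists (Sub y Ay), x; split=> //; last first.
  by move=> w; rewrite codom_val.
have /card_gt1P[a [b []]] := ltnW ch; rewrite !inE => ya yb ab.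
apply/innerP; have [ax|ax] := eqVneq a x.
  have Ab : A b by rewrite /A /= -ax eq_sym.
  by exists (Sub b Ab); rewrite -lt_val !SubK covers_lt.
by exists (Sub a ax); rewrite -lt_val !SubK covers_lt.
Qed.

(** Without [x2], the node [y] would keep a single child, so [y] is deleted as well and [x1] moves
    up to become a child of [z]. *)
Lemma remove_leaf_and_parent (x1 x2 z : P) :
    x1 != x2 -> children y = [set x1; x2] -> leaf x1 -> leaf x2 ->
    covers z y ->
  let A : pred P := [pred w | w \notin [:: x2; y]] in
  merge_tree_type (subposet A) /\
  adds_leaf_with_parent (val : subposet A -> P).
Proof.
move=> x12 ch l1 l2 zy A.
have [r [rM chain two]] := treeP.
have yx w : covers y w = (w == x1) || (w == x2).
  by move/setP/(_ w): ch; rewrite !inE.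
have yx1 : covers y x1 by rewrite yx eqxx.
have yx2 : covers y x2 by rewrite yx eqxx orbT.
have Alt w u : u < w -> w != y -> A w.
  move=> uw wy; rewrite /A /= !inE negb_or wy andbT.
  by apply: contraTneq uw => ->; exact: (leafP _ l2).
have Ax1 : A x1 by rewrite /A /= !inE negb_or x12 /= lt_eqF // covers_lt.
have Az : A z by apply: (Alt _ _ (covers_lt zy)); rewrite gt_eqF // covers_lt.
have Ar : A r.
  have yr := lt_le_trans (covers_lt zy) (rM z).
  by apply: (Alt _ _ yr); rewrite gt_eqF.
pose X1 : subposet A := Sub x1 Ax1; pose Z : subposet A := Sub z Az.
have ZX1 : covers Z X1.
  rewrite /covers -lt_val !SubK (lt_trans (covers_lt yx1) (covers_lt zy)).
  apply/forallP => u; apply/negP => /andP[]; rewrite -!lt_val !SubK => xu uz.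
  (* Both [u] and [y] lie above [x1], hence are comparable; so [u] would fall strictly inside the
     cover of [x1] by [y] or that of [y] by [z]. *)
  have : val u >=< y.
    by apply: (chain x1); rewrite inE rM andbT ltW // covers_lt.
  have := valP u; rewrite /A /= !inE negb_or => /andP[_ /negPf uy].
  case: comparableP uy => // [uy|yu] _ _.
    exact: covers_between yx1 xu uy.
  exact: covers_between zy yu uz.
(* [x1] takes the place of [y] among the children of [z]. *)
have lift_child (w : subposet A) (a : P) : covers (val w) a ->
    exists a' : subposet A, covers w a' /\ val a' = if a == y then x1 else a.
  move=> wa; have [ay|ay] := eqVneq a y.
    exists X1; split; last by rewrite SubK.
    suff -> : w = Z by [].
    by apply: val_inj; rewrite SubK; apply: (parent_unique treeP _ zy);
      move: wa; rewrite ay.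
  have Aa : A a.
    rewrite /A /= !inE negb_or ay andbT; apply/eqP => ax2; have := valP w.
    rewrite /A /= !inE negb_or => /andP[_ /eqP]; apply.
    by apply: (parent_unique treeP _ yx2); move: wa; rewrite ax2.
  by exists (Sub a Aa); rewrite SubK; split=> //; apply: covers_subposet.
split.
  apply: (merge_tree_type_subposet treeP Ar rM) => w.
  move=> /innerP[u]; rewrite -lt_val => uw.
  have /card_gt1P[a [b []]] : (1 < #|children (val w)|)%N.
    by apply: two; apply/innerP; exists (val u).
  rewrite !inE => wa wb ab.
  (* The only parent of [x1] in [P] is the deleted [y], so [x1] is not yet a child of [w], and
     substituting it for [y] keeps the two children distinct. *)
  have wNx1 c : covers (val w) c -> c != x1.
    apply: contraTneq => ->; apply/negP => wx1; have := valP w.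
    rewrite /A /= !inE negb_or => /andP[_ /eqP]; apply.
    exact: parent_unique treeP wx1 yx1.
  have [a' [wa' a'E]] := lift_child w a wa.
  have [b' [wb' b'E]] := lift_child w b wb.
  apply/card_gt1P; exists a', b'; rewrite !inE; split=> //.
  rewrite -val_eqE a'E b'E; have [ay|ay] := eqVneq a y.
    by move: ab; rewrite ay eq_sym => /negPf->; rewrite eq_sym wNx1.
  by case: ifP => // _; exact: wNx1.
exists X1, Z, x2, y; split=> //.
- split; first by rewrite lt_eqF // covers_lt.
  by move=> w; rewrite codom_val.
- by rewrite ch finset.setUC.
Qed.

Lemma remove_two_leaves (x1 x2 : P) :
    x1 != x2 -> children y = [set x1; x2] -> leaf x1 -> leaf x2 ->
    (forall w, ~~ (y < w)) ->
  let A : pred P := pred1 y in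
  merge_tree_type (subposet A) /\
  adds_two_leaves_to_point (val : subposet A -> P).
Proof.
move=> x12 ch l1 l2 yM A.
have [r [rM _ _]] := treeP.
have yr : y = r.
  by apply/eqP; have := yM r; rewrite lt_neqAle rM andbT negbK.
have yx w : covers y w = (w == x1) || (w == x2).
  by move/setP/(_ w): ch; rewrite !inE.
have yx1 : covers y x1 by rewrite yx eqxx.
have yx2 : covers y x2 by rewrite yx eqxx orbT.
have Ay : A y by rewrite /A /=.
have Q1 (w : subposet A) : w = Sub y Ay.
  by apply: val_inj; rewrite SubK; apply/eqP; exact: (valP w).
split.
  apply: (merge_tree_type_subposet treeP Ay) => [x|w]; first by rewrite yr.
  by case/innerP=> u; rewrite (Q1 u) (Q1 w) ltxx.
exists (Sub y Ay), x1, x2; split=> //.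
split=> // w; rewrite codom_val /A /= !inE.
apply/eqP/idP => [->|].
  by rewrite !gt_eqF // covers_lt.
rewrite negb_or => /andP[w1 w2]; apply/eqP; apply: contraT => wy.
have wlty : w < y by rewrite lt_neqAle wy yr rM.
(* Below the root [y], the element [w] lies under one of the leaves [x1], [x2], and hence equals
   it. *)
have [c] := exists_child wlty; rewrite yx le_eqVlt.
by case/pred2P=> ->; rewrite (negPf (leafP _ _ _)) // orbF (negPf w1, negPf w2).
Qed.

End Pruning.

(** The removal is recorded through its inverse, the addition [Q -> P]. The drop in cardinality
    drives the induction in [edit_path_to_singleton]. *)
Lemma exists_leaf_removal P : merge_tree_type P -> (1 < #|P|)%N ->
  exists (Q : finPOrderType d) (eta : Q -> P) (o : P -> option Q),
    [/\ merge_tree_type Q, adds_leaf eta o & (#|Q| < #|P|)%N].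
Proof.
move=> treeP cardP; have [r [rM _ two]] := treeP.
have inner_r : inner r.
  have /card_gt1P[a [b [_ _ ab]]] := cardP; apply/innerP.
  have [ar|ar] := eqVneq a r; last by exists a; rewrite lt_neqAle ar rM.
  by exists b; rewrite lt_neqAle rM andbT -ar eq_sym.
have [y inner_y ymin] := exists_minimal (A := @inner d P) inner_r.
have leaf_child x : covers y x -> leaf x.
  by move=> /covers_lt xy; apply: contraTT xy => /ymin.
have sub_card (A : pred P) x : ~~ A x -> (#|subposet A : finType| < #|P|)%N.
  move=> Ax; rewrite card_sig; apply: proper_card.
  by apply/fintype.properP; split; [exact/fintype.subsetP|exists x].
suff [A [x [Ax tA mA]]] : exists (A : pred P) (x : P),
    [/\ ~~ A x, merge_tree_type (subposet A)
      & adds_leaf (val : subposet A -> P) insub].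
  by exists (subposet A), val, insub; split=> //; exact: sub_card Ax.
have := two y inner_y; rewrite leq_eqVlt => /orP[|ch]; last first.
  have /card_gt1P[x [_ [+ _ _]]] := ltnW ch; rewrite inE => yx.
  have [tA mA] := remove_leaf_sibling treeP yx (leaf_child _ yx) ch.
  exists (predC1 x), x; split=> //=; first by rewrite eqxx.
  by apply: adds_leaf_subposet; exact: Or31.
rewrite eq_sym => /cards2P[x1 [x2 [x12 ch]]].
have l1 : leaf x1.
  by apply: leaf_child; move/setP/(_ x1): ch; rewrite !inE eqxx.
have l2 : leaf x2.
  by apply: leaf_child; move/setP/(_ x2): ch; rewrite !inE eqxx orbT.
have [/existsP[z /exists_parent[p py]]|/existsPn yM] := boolP [exists z, y < z].
  have [tA mA] := remove_leaf_and_parent treeP x12 ch l1 l2 py.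
  exists [pred w | w \notin [:: x2; y]], y; split=> //=.
    by rewrite !inE eqxx orbT.
  by apply: adds_leaf_subposet; exact: Or32.
have [tA mA] := remove_two_leaves treeP x12 ch l1 l2 yM.
exists (pred1 y), x1; split=> //=.
  by move/setP/(_ x1): ch; rewrite !inE eqxx => /covers_lt/lt_eqF->.
by apply: adds_leaf_subposet; exact: Or33.
Qed.

End MergeTreePosets.

(** * Inverting edit morphisms *)

Section MoveInversion.
Context {d : Order.disp_t} {Mer_comb : representatives d}.
Implicit Types P Q S : Mer_comb.

(** The automorphism acts on the target for a growth, but on the source of the growing data for a
    shrinking. For additions and splittings it is absorbed into the move by isomorphism invariance;
    for the identity move its inverse is used on the other side. *)
Lemma elementary_growth_shrinking P P' (eta : P -> P') (o : P' -> option P) :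
  elementary_growth eta o -> elementary_shrinking_inv eta o.
Proof.
move=> [eta0 [o0 [phi [m [bij_phi mono_phi] etaE oE]]]].
have omap_id T (u : option T) : u = omap id u by case: u.
case: P P' eta0 o0 / m phi bij_phi mono_phi eta o etaE oE =>
    [P|P P' eta0 o0 m|P P' eta0 o0 m] phi bij_phi mono_phi eta o etaE oE.
- have [psi phiK psiK] := bij_phi.
  exists id, Some, psi; split; first exact: move_id.
  + by split; [exists phi|move=> x y; rewrite -mono_phi !psiK].
  + by move=> x; rewrite etaE psiK.
  + by move=> x; rewrite -[x in LHS]psiK oE.
- exists eta, o, id; split=> //; [|by split=> //; exists id].
  apply/move_add/(adds_leaf_iso (f := id) (g := phi) _ _ _ _ _ _ m) => //.
    by exists id.
  by move=> x; rewrite oE -omap_id.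
- exists eta, o, id; split=> //; [|by split=> //; exists id].
  apply/move_split.
  apply: (splits_inner_node_iso (f := id) (g := phi) _ _ _ _ _ _ m) => //.
    by exists id.
  by move=> x; rewrite oE -omap_id.
Qed.

Lemma elementary_shrinking_growth P P' (eta : P -> P') (o : P' -> option P) :
  elementary_shrinking_inv eta o -> elementary_growth eta o.
Proof.
move=> [eta0 [o0 [phi [m [bij_phi mono_phi] etaE oE]]]].
case: P P' eta0 o0 / m phi bij_phi mono_phi eta o etaE oE =>
    [P|P P' eta0 o0 m|P P' eta0 o0 m] phi bij_phi mono_phi eta o etaE oE.
- have [psi phiK psiK] := bij_phi.
  exists id, Some, psi; split; first exact: move_id.
  + by split; [exists phi|move=> x y; rewrite -mono_phi !psiK].
  + by move=> x; rewrite -[x in LHS]psiK etaE.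
  + by move=> x; rewrite oE /= psiK.
- exists eta, o, id; split=> //; [|by split=> //; exists id].
  apply/move_add/(adds_leaf_iso (f := phi) (g := id) _ _ _ _ _ _ m) => //.
  by exists id.
- exists eta, o, id; split=> //; [|by split=> //; exists id].
  apply/move_split.
  apply: (splits_inner_node_iso (f := phi) (g := id) _ _ _ _ _ _ m) => //.
  by exists id.
Qed.

Lemma composite_sub (E E' : forall P P', (P -> P') -> (P' -> option P) -> Prop)
    P P' (eta : P -> P') (o : P' -> option P) :
  (forall P P' eta o, @E P P' eta o -> @E' P P' eta o) ->
  composite E eta o -> composite E' eta o.
Proof.
move=> EE'; elim=> {P P' eta o} [P P' eta o /EE'|].
  exact: composite_one.
move=> P Q P' eta1 o1 eta2 o2 _ c1 _ c2; exact: composite_comp.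
Qed.

(** Both constructors store growing data, so inversion keeps [eta] and [o] and only changes the
    direction. This is why the step cost is preserved by computation. *)
Definition inverse_morphism P Q (m : edit_morphism P Q) : edit_morphism Q P :=
  match m with
  | Grow eta o c => Shrink (composite_sub elementary_growth_shrinking c)
  | Shrink eta o c => Grow (composite_sub elementary_shrinking_growth c)
  end.

Lemma elementary_growth_id P : elementary_growth (@id P) Some.
Proof.
exists id, Some, id; split=> //; first exact: move_id.
by split=> //; exists id.
Qed.

Definition identity_morphism P : edit_morphism P P :=
  Grow (composite_one (elementary_growth_id P)).

End MoveInversion.

(** * Costs of concatenated and reversed paths *)

Section PathCosts.
Context {R : realType} {d : Order.disp_t} {Mer_comb : representatives d}.
Implicit Types P Q S : Mer_comb.

Local Open Scope ring_scope.

Lemma step_cost_inverse P Q (m : edit_morphism P Q) (theta : P -> R)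
    (theta' : Q -> R) :
  step_cost (inverse_morphism m) theta' theta = step_cost m theta theta'.
Proof. by case: m. Qed.

Lemma step_cost_ge0 P Q (m : edit_morphism P Q) (theta : P -> R)
    (theta' : Q -> R) :
  0 <= step_cost m theta theta'.
Proof. by case: m => *; exact: sqrtr_ge0. Qed.

Lemma path_cost_ge0 P Q (gamma : edit_path P Q) (theta : P -> R)
    (theta' : Q -> R) (h : heights gamma) :
  0 <= path_cost theta theta' h.
Proof.
elim: gamma theta theta' h => {P Q} [P Q m|P Q S m gamma IH] theta theta' h /=.
  exact: step_cost_ge0.
by rewrite addr_ge0 // step_cost_ge0.
Qed.

(** The height function at the junction becomes an intermediate one of the new path, so [thetaQ]
    must be order preserving, while the outer two may be arbitrary. The path is chosen before any
    heights. *)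
Lemma path_cost_cat P Q S (gamma1 : edit_path P Q) (gamma2 : edit_path Q S) :
  exists gamma : edit_path P S,
    forall (theta : P -> R) (thetaQ : {omorphism Q -> R}) (theta' : S -> R)
           (h1 : heights gamma1) (h2 : heights gamma2),
    exists h : heights gamma,
      path_cost theta theta' h =
      path_cost theta thetaQ h1 + path_cost thetaQ theta' h2.
Proof.
elim: gamma1 gamma2 => {P Q} [P Q m|P Q T m gamma1 IH] gamma2.
  exists (path_cons m gamma2) => theta thetaQ theta' h1 h2.
  by exists (thetaQ, h2).
have [gamma gammaE] := IH gamma2.
exists (path_cons m gamma) => theta thetaT theta' [h h1] h2.
have [h' h'E] := gammaE h thetaT theta' h1 h2.
by exists (h, h'); rewrite /= h'E addrA.
Qed.

(** The inverse of the first step is appended to the reversed tail, with the first intermediate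
    height as junction. *)
Lemma path_cost_rev P Q (gamma : edit_path P Q) :
  exists gamma' : edit_path Q P,
    forall (theta : P -> R) (theta' : Q -> R) (h : heights gamma),
    exists h' : heights gamma',
      path_cost theta' theta h' = path_cost theta theta' h.
Proof.
elim: gamma => {P Q} [P Q m|P Q S m gamma [gamma' IH]].
  exists (path_one (inverse_morphism m)) => theta theta' h.
  by exists tt; exact: step_cost_inverse.
have [delta deltaE] := path_cost_cat gamma' (path_one (inverse_morphism m)).
exists delta => theta theta' [h h1]; have [h' h'E] := IH h theta' h1.
have [k kE] := deltaE theta' h theta h' tt.
by exists k; rewrite kE h'E /= step_cost_inverse addrC.
Qed.

Lemma step_cost_id P (theta : P -> R) :
  step_cost (identity_morphism P) theta theta = 0.
Proof.
rewrite /= /euclidean_norm big1 ?sqrtr0 // => x _.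
rewrite /shift; case: pickP => [z /eqP->|/(_ x)]; last by rewrite eqxx.
by rewrite subrr expr0n.
Qed.

End PathCosts.

(** * Connecting any two trees *)

Section Connectivity.
Context {d : Order.disp_t} {Mer_comb : representatives d}.
Implicit Types P Q S : Mer_comb.

(** Finiteness requires just some path with some heights, so no costs are tracked from here on. *)
Lemma edit_path_cat P Q S : edit_path P Q -> edit_path Q S -> edit_path P S.
Proof.
move=> gamma; elim: gamma S => {P Q} [P Q m|P Q T m _ IH] S.
  exact: path_cons.
by move=> /IH; exact: path_cons.
Qed.

Lemma edit_path_rev P Q : edit_path P Q -> edit_path Q P.
Proof.
elim=> {P Q} [P Q m|P Q S m _ gamma].
  exact: path_one (inverse_morphism m).
exact: edit_path_cat gamma (path_one (inverse_morphism m)).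
Qed.

(** One-point posets are isomorphic, and an isomorphism class has a single representative. Hence an
    equality of indices, which lets two reductions meet. *)
Lemma singleton_unique P S : #|P| = 1%N -> #|S| = 1%N -> P = S.
Proof.
move=> /eqP/fintype1P[p pU] /eqP/fintype1P[s sU].
have [K [_ KU]] := rep_unique Mer_comb (rep_merge_tree_type P).
rewrite -(KU P); last by exists id => //; exists id.
apply: KU; exists (fun=> s) => [|x y].
  by exists (fun=> p) => z; rewrite (pU, sU).
by rewrite (pU x) (pU y) !lexx.
Qed.

Lemma edit_path_to_singleton P :
  exists2 S : Mer_comb, #|S| = 1%N & inhabited (edit_path P S).
Proof.
have [n] := ubnP #|P|; elim: n P => // n IH P Pn.
have [P1|] := leqP #|P| 1.
  exists P; last exact: inhabits (path_one (identity_morphism P)).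
  apply/eqP; rewrite eqn_leq P1; apply/card_gt0P.
  by have [r _] := rep_merge_tree_type P; exists r.
have treeP := rep_merge_tree_type P.
move=> /(exists_leaf_removal treeP)[Q [eta [o [treeQ add QP]]]].
(* The pruned poset [Q] need not be a chosen representative, so the addition is transported to its
   representative [Q']. *)
have [Q' [[f bij_f mono_f] _]] := rep_unique Mer_comb treeQ.
have [g fK gK] := bij_f.
have add' : adds_leaf (eta \o g : Q' -> P) (omap f \o o).
  apply: (adds_leaf_iso (f := f) (g := id) _ _ _ _ _ _ add) => //.
    by exists id.
  by move=> x /=; rewrite fK.
have growth : elementary_growth (eta \o g : Q' -> P) (omap f \o o).
  exists (eta \o g), (omap f \o o), id; split=> //; first exact: move_add.
  by split=> //; exists id.
have [|S S1 [gamma]] := IH Q'.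
  by rewrite -(bij_eq_card bij_f) (leq_trans QP).
exists S => //; constructor.
exact: path_cons (inverse_morphism (Grow (composite_one growth))) gamma.
Qed.

Lemma edit_path_exists P Q : inhabited (edit_path P Q).
Proof.
have [S S1 [gamma]] := edit_path_to_singleton P.
have [T T1 [gamma']] := edit_path_to_singleton Q.
rewrite (singleton_unique T1 S1) in gamma'.
exact: inhabits (edit_path_cat gamma (edit_path_rev gamma')).
Qed.

Lemma omorphism_inhabited (R : realType) P : inhabited {omorphism P -> R}.
Proof.
pose c : P -> R := fun=> 0%R.
have c_le : {homo c : x y / x <= y} by [].
pose mixin := Order.isOrderMorphism.Build _ _ _ _ c c_le.
exact: inhabits (HB.pack c mixin : {omorphism P -> R}).
Qed.

Lemma heights_inhabited (R : realType) P Q (gamma : edit_path P Q) :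
  inhabited (heights (R := R) gamma).
Proof.
elim: gamma => {P Q} [P Q m|P Q S m gamma [h]]; first exact: inhabits tt.
by have [theta] := omorphism_inhabited R Q; exact: inhabits (theta, h).
Qed.

End Connectivity.

(** * The pseudo-metric axioms *)

Section EditDistance.
Context {R : realType} {d : Order.disp_t} {Mer_comb : representatives d}.
Implicit Types theta : Mer R Mer_comb.

Local Open Scope ereal_scope.

(** Pairing a path with its heights merges the two nested infima of the distance into a single
    one. *)
Definition attained_cost theta theta' (c : R) : Prop :=
  exists (gamma : edit_path (domain theta) (domain theta')) (h : heights gamma),
    c = path_cost (height theta) (height theta') h.

Lemma edit_distance_le theta theta' c :
  attained_cost theta theta' c -> edit_distance theta theta' <= c%:E.
Proof.
move=> [gamma [h ->]]; apply: ge_ereal_inf.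
exists (path_length gamma (height theta) (height theta')).
  by exists gamma.
by apply: ge_ereal_inf; eexists; first by exists h.
Qed.

Lemma le_edit_distance theta theta' x :
  (forall c, attained_cost theta theta' c -> x <= c%:E) ->
  x <= edit_distance theta theta'.
Proof.
move=> xle; apply/ereal_infP => _ [gamma _ <-].
by apply/ereal_infP => _ [h _ <-]; apply: xle; exists gamma, h.
Qed.

Lemma edit_distance_ge0 theta theta' : 0 <= edit_distance theta theta'.
Proof.
apply: le_edit_distance => _ [gamma [h ->]].
by rewrite lee_fin path_cost_ge0.
Qed.

Lemma edit_distance_lty theta theta' : edit_distance theta theta' < +oo.
Proof.
have [gamma] := edit_path_exists (domain theta) (domain theta').
have [h] := heights_inhabited R gamma.
by apply: le_lt_trans (ltry _); apply: edit_distance_le; exists gamma, h.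
Qed.

Lemma edit_distance_refl theta : edit_distance theta theta = 0.
Proof.
apply/eqP; rewrite eq_le edit_distance_ge0 andbT; apply: edit_distance_le.
exists (path_one (identity_morphism _)), tt.
exact/esym/step_cost_id.
Qed.

Lemma edit_distance_sym_le theta theta' :
  edit_distance theta theta' <= edit_distance theta' theta.
Proof.
apply: le_edit_distance => _ [gamma [h ->]].
have [gamma' /(_ (height theta') (height theta) h)[h' h'E]] :=
  path_cost_rev (R := R) gamma.
by apply: edit_distance_le; exists gamma', h'.
Qed.

Lemma edit_distance_triangle theta1 theta2 theta3 :
  edit_distance theta1 theta3 <=
  edit_distance theta1 theta2 + edit_distance theta2 theta3.
Proof.
have fin12 : edit_distance theta1 theta2 \is a fin_num.
  by rewrite ge0_fin_numE ?edit_distance_ge0 ?edit_distance_lty.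
(* Subtraction of extended reals needs a finite term: first the finite distance is moved across to
   reach a cost [c2], then the real [c2] to reach a cost [c1]. *)
rewrite addeC -leeBlDr //; apply: le_edit_distance => c2 [gamma2 [h2 c2E]].
rewrite leeBlDr // addeC -leeBlDr //.
apply: le_edit_distance => c1 [gamma1 [h1 c1E]].
rewrite leeBlDr // -EFinD; apply: edit_distance_le.
have [gamma gammaE] := path_cost_cat (R := R) gamma1 gamma2.
have [h hE] := gammaE (height theta1) (height theta2) (height theta3) h1 h2.
by exists gamma, h; rewrite hE c1E c2E.
Qed.

(** The axioms hold on all of [Mer] and pass to every subset, so the three cases of the theorem need
    no separate argument. *)
Lemma edit_distance_pseudo_metric_on (A : set (Mer R Mer_comb)) :
  pseudo_metric_on A edit_distance.
Proof.
split=> [x y _ _|x _|x y _ _|x y z _ _ _].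
- by rewrite edit_distance_ge0 edit_distance_lty.
- exact: edit_distance_refl.
- by apply/eqP; rewrite eq_le !edit_distance_sym_le.
- exact: edit_distance_triangle.
Qed.

End EditDistance.

Theorem proposition4p39 (R : realType) (d : Order.disp_t)
    (Mer_comb : representatives d) :
  [/\ pseudo_metric_on (@setT (Mer R Mer_comb)) edit_distance,
      pseudo_metric_on (@Mer_st R d Mer_comb) edit_distance
    & pseudo_metric_on (@Mer_wb R d Mer_comb) edit_distance].
Proof. by split; exact: edit_distance_pseudo_metric_on. Qed.
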